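(* Fix a constant $b \in \mathbb{N}$. There is an algorithm which, given any multi-set $S$ of $n$ binary strings of length $b$, solves the meshing problem for $S$ (i.e. outputs a meshing of $S$ that releases the maximum possible number of strings) in time polynomial in $n$. In other words, for strings of constant length the meshing problem is in $P$.
   Context: Two binary strings $s_1, s_2 \in \{0,1\}^b$ are said to \emph{mesh} iff $\sum_{i=1}^{b} s_1(i)\, s_2(i) = 0$, i.e. they have no position at which both equal $1$. A set (or sub-multi-set) of strings meshes if every pair of distinct members of it meshes. A \emph{meshing} of a multi-set $S$ of $n$ strings is a partition of $S$ into sub-multi-sets each of which meshes; if the partition has $k$ parts, it \emph{releases} $n-k$ strings. The \emph{meshing problem} for $S$ is: find a meshing of $S$ that releases the maximum number of strings (equivalently, a partition of $S$ into the minimum number of meshing parts). *)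

(* Defs.v *)
From mathcomp Require Import all_boot.
Set Implicit Arguments. Unset Strict Implicit. Unset Printing Implicit Defensive.

Definition bstring (b : nat) := b.-tuple bool.

Definition mesh (b : nat) (s1 s2 : bstring b) : bool :=
  [forall i : 'I_b, ~~ (tnth s1 i && tnth s2 i)].

(* A multiset S of n strings is represented by a sequence (order irrelevant).
   A partition of S into k parts is represented by a labeling [lab] assigning
   to the i-th element of S the index of its part; the parts are the classes
   of equal labels, and k = number of distinct labels. *)
Definition is_meshing (b : nat) (S : seq (bstring b)) (lab : seq nat) : Prop :=
  size lab = size S /\
  forall i j, i < j -> j < size S -> nth 0 lab i = nth 0 lab j ->
    mesh (nth [tuple of nseq b false] S i) (nth [tuple of nseq b false] S j).

Definition num_parts (lab : seq nat) : nat := size (undup lab).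

Definition releases (b : nat) (S : seq (bstring b)) (lab : seq nat) : nat :=
  size S - num_parts lab.

Definition optimal_meshing (b : nat) (S : seq (bstring b)) (lab : seq nat) : Prop :=
  is_meshing S lab /\
  forall lab', is_meshing S lab' -> releases S lab' <= releases S lab.

Inductive Sym := S0 | S1 | Sep.
Inductive Mv := MvL | MvR | MvN.

(* Tape alphabet: blank (None), I/O symbols, and a finite work alphabet W. *)
Unset Implicit Arguments.
Record TM := {
  tm_Q : finType;
  tm_W : finType;
  tm_start : tm_Q;
  tm_halt : tm_Q -> bool;
  tm_delta : tm_Q -> option (Sym + tm_W) -> tm_Q * option (Sym + tm_W) * Mv
}.

Set Implicit Arguments.
Definition cell (M : TM) := option (Sym + tm_W M).

(* configuration: state, reversed left part, head cell, right part
   (cells beyond the listed ones are blank; two-way infinite tape). *)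
Definition config (M : TM) := (tm_Q M * seq (cell M) * cell M * seq (cell M))%type.

Definition tm_step (M : TM) (c : config M) : config M :=
  let: (q, l, h, r) := c in
  if tm_halt M q then c else
  let: (q', w, m) := tm_delta M q h in
  match m with
  | MvN => (q', l, w, r)
  | MvL => match l with
           | [::] => (q', [::], None, w :: r)
           | x :: l' => (q', l', x, w :: r)
           end
  | MvR => match r with
           | [::] => (q', w :: l, None, [::])
           | x :: r' => (q', w :: l, x, r')
           end
  end.

Definition tm_init (M : TM) (w : seq Sym) : config M :=
  let t := [seq (Some (inl a) : cell M) | a <- w] in
  (tm_start M, [::], head None t, behead t).

Definition tm_run (M : TM) (t : nat) (w : seq Sym) : config M :=
  iter t (@tm_step M) (tm_init M w).

Fixpoint read_out (M : TM) (s : seq (cell M)) : seq Sym :=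
  match s with
  | Some (inl a) :: s' => a :: read_out s'
  | _ => [::]
  end.

Definition tm_outputs_within (M : TM) (t : nat) (w o : seq Sym) : Prop :=
  let: (q, l, h, r) := tm_run M t w in
  tm_halt M q /\ read_out (h :: r) = o.

Definition enc_input (b : nat) (S : seq (bstring b)) : seq Sym :=
  flatten [seq [seq (if x then S1 else S0) | x <- s] ++ [:: Sep] | s <- [seq val s | s <- S]].

Definition enc_labels (lab : seq nat) : seq Sym :=
  flatten [seq nseq k S1 ++ [:: Sep] | k <- lab].

(* Main.v *)
Require Import Defs.
From HB Require Import structures.
From mathcomp Require Import all_boot.
From mathcomp Require Import zify.
From Stdlib Require Import Classical.
Set Implicit Arguments. Unset Strict Implicit. Unset Printing Implicit Defensive.

(** A part of a meshing is described by its kind, the set of string types occurring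
    in it, and for fixed [b] there are finitely many kinds. A meshing with the kinds
    [Ks] is improved by an exchange [(p, q)]: the parts of kinds [p] are replaced by
    fewer parts of kinds [q] covering every nonzero type equally often. By Dickson's
    lemma finitely many exchanges suffice: if some meshing is better than [Ks], then
    one of these basic exchanges applies to [Ks]. So local search with a fixed finite
    set of exchanges reaches an optimum, after at most [n] improvements.

    One improvement takes two sweeps of a Turing machine over [n] cells, each holding
    a kind: the sweep to the right counts every kind up to a constant and then selects
    an exchange, the sweep to the left performs it. Afterwards every string is put
    greedily into the first cell whose kind still offers its type; the index of the
    cell is the label, written in unary with one symbol per pair of sweeps. *)

(** * Sweeping Turing machines *)

Section Scan.
Variables (P W : Type) (f : P -> W -> P * W).

Fixpoint scan (p : P) (ws : seq W) : P * seq W :=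
  if ws is w :: ws' then
    let: (p1, w1) := f p w in let: (p2, ws2) := scan p1 ws' in (p2, w1 :: ws2)
  else (p, [::]).

Lemma scan_cons p w ws :
  scan p (w :: ws) =
  ((scan (f p w).1 ws).1, (f p w).2 :: (scan (f p w).1 ws).2).
Proof. by rewrite /=; case: (f p w) => p1 w1 /=; case: scan. Qed.

Lemma scan_id p ws : (forall w, f p w = (p, w)) -> scan p ws = (p, ws).
Proof. by move=> fp; elim: ws => //= w ws IH; rewrite fp IH. Qed.

Lemma scan_cat p ws1 ws2 :
  scan p (ws1 ++ ws2) =
  ((scan (scan p ws1).1 ws2).1, (scan p ws1).2 ++ (scan (scan p ws1).1 ws2).2).
Proof.
elim: ws1 p => [|w ws1 IH] p; first by case: (scan p ws2).
by rewrite cat_cons !scan_cons IH.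
Qed.

Lemma size_scan p ws : size (scan p ws).2 = size ws.
Proof. by elim: ws p => // w ws IH p; rewrite scan_cons /= IH. Qed.

End Scan.

Lemma pmap_rev (X Y : Type) (f : X -> option Y) s : pmap f (rev s) = rev (pmap f s).
Proof.
elim: s => // x s IH; rewrite rev_cons -cats1 pmap_cat IH /=.
by case: (f x) => [y|] /=; rewrite ?cats0 // rev_cons cats1.
Qed.

(* A machine that sweeps right and left over its data cells, rewriting them by a
   finite transducer, and may append one output symbol at each right turn. Cells
   [Some (inr None)] are the remains of input symbols that carry no data. *)
Inductive sweep_state (I P : Type) :=
  LoadInput of I | RightScan of P | OutScan of P | LeftScan of P | Halted.

Section SweepState.
Variables (I P : finType).

Definition sweep_state_code (q : sweep_state I P) : option (I + (P + (P + P))) :=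
  match q with
  | LoadInput i => Some (inl i)
  | RightScan p => Some (inr (inl p))
  | OutScan p => Some (inr (inr (inl p)))
  | LeftScan p => Some (inr (inr (inr p)))
  | Halted => None
  end.

Definition sweep_state_decode (c : option (I + (P + (P + P)))) : sweep_state I P :=
  match c with
  | Some (inl i) => LoadInput P i
  | Some (inr (inl p)) => RightScan I p
  | Some (inr (inr (inl p))) => OutScan I p
  | Some (inr (inr (inr p))) => LeftScan I p
  | None => Halted I P
  end.

Lemma sweep_state_codeK : cancel sweep_state_code sweep_state_decode.
Proof. by case. Qed.

HB.instance Definition _ := Finite.copy (sweep_state I P) (can_type sweep_state_codeK).

End SweepState.

Section Sweeper.
Variables (I P W : finType) (i0 : I) (p0 : P).
Variables (load : I -> Sym -> I * option W).
Variables (fR fL : P -> W -> P * W) (final : P -> bool).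
Variables (act : P -> P * option Sym) (turn : P -> P).

Definition lift_cell (f : P -> W -> P * W) (p : P) (x : option W) : P * option W :=
  if x is Some w then let: (p', w') := f p w in (p', Some w') else (p, None).

(** Blanks delimit the tape contents: the right one receives the output of [act], the left one
    triggers [turn]. A right sweep ends at the first output symbol or blank, and [final] is tested
    there, before the output is crossed. *)
Definition sweep_delta (q : sweep_state I P) (h : option (Sym + option W)) :
    sweep_state I P * option (Sym + option W) * Mv :=
  match q, h with
  | LoadInput i, Some (inl a) =>
      let: (i', x) := load i a in (LoadInput P i', Some (inr x), MvR)
  | LoadInput _, _ => (LeftScan I p0, None, MvL)
  | RightScan p, Some (inr x) =>
      let: (p', x') := lift_cell fR p x in (RightScan I p', Some (inr x'), MvR)
  | RightScan p, _ => (if final p then Halted I P else OutScan I p, h, MvN)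
  | OutScan p, None => let: (p', o) := act p in (LeftScan I p', omap inl o, MvL)
  | OutScan p, _ => (q, h, MvR)
  | LeftScan p, None => (RightScan I (turn p), None, MvR)
  | LeftScan p, Some (inl a) => (q, h, MvL)
  | LeftScan p, Some (inr x) =>
      let: (p', x') := lift_cell fL p x in (LeftScan I p', Some (inr x'), MvL)
  | Halted, _ => (q, h, MvN)
  end.

Definition sweeper : TM :=
  @Build_TM (sweep_state I P) (option W) (LoadInput P i0)
    (fun q => if q is Halted then true else false) sweep_delta.

Fixpoint load_all (i : I) (w : seq Sym) : seq W :=
  if w is a :: w' then
    let: (i', x) := load i a in
    if x is Some y then y :: load_all i' w' else load_all i' w'
  else [::].

Definition back_sweep (p : P) (ws : seq W) (out : seq Sym) : P * seq W * seq Sym :=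
  let: (p', ws') := scan fL p (rev ws) in (turn p', rev ws', out).

(** If the right sweep ends in a final phase, nothing changes: [round_run] then takes zero steps,
    and the halting sweep is accounted for in [sweeper_outputs]. *)
Definition round (c : P * seq W * seq Sym) : P * seq W * seq Sym :=
  let: (p, ws, out) := c in
  let: (p1, ws1) := scan fR p ws in
  if final p1 then c
  else back_sweep (act p1).1 ws1 (out ++ seq_of_opt (act p1).2).

Local Notation tcell := (option (Sym + option W)).
Local Notation step := (@tm_step sweeper).
Local Notation wcell x := (Some (inr x) : tcell).
Local Notation ocell a := (Some (inl a) : tcell).
Local Notation blanks n := (nseq n (None : tcell)).

(* Head on the first cell of [t] (resp. of the reversed left part [l]). *)
Definition on_right (q : sweep_state I P) (l t : seq tcell) : config sweeper :=
  (q, l, head None t, behead t).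
Definition on_left (q : sweep_state I P) (l t : seq tcell) : config sweeper :=
  (q, behead l, head None l, t).

Local Notation lift_scan f := (scan (lift_cell f)).

(** Cells without data pass through the lifted transducer unchanged, so a sweep over the tape
    projects to a sweep over the data. *)
Lemma pmap_lift_scan f p cs :
  (lift_scan f p cs).1 = (scan f p (pmap id cs)).1 /\
  pmap id (lift_scan f p cs).2 = (scan f p (pmap id cs)).2.
Proof.
elim: cs p => // x cs IH p; rewrite scan_cons.
case: x => [w|] /=; last by have [-> ->] := IH p.
case fw: (f p w) => [p1 w1] /=; have [-> ->] := IH p1.
by case: (scan f p1 _).
Qed.

Lemma right_scan_run p cs l t :
  iter (size cs) step (on_right (RightScan I p) l ([seq wcell x | x <- cs] ++ t)) =
  on_right (RightScan I (lift_scan fR p cs).1)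
    (catrev [seq wcell x | x <- (lift_scan fR p cs).2] l) t.
Proof.
elim: cs p l => // x cs IH p l.
rewrite scan_cons iterSr /= -IH; congr iter.
rewrite /tm_step /=; case: lift_cell => p1 x1 /=.
by case: ([seq _ | _ <- _] ++ t).
Qed.

Lemma out_scan_run p out l t :
  iter (size out) step (on_right (OutScan I p) l ([seq ocell a | a <- out] ++ t)) =
  on_right (OutScan I p) (catrev [seq ocell a | a <- out] l) t.
Proof.
elim: out l => // a out IH l; rewrite iterSr /= -IH; congr iter.
by rewrite /tm_step /=; case: ([seq _ | _ <- _] ++ t).
Qed.

Lemma left_scan_run p cs l t :
  iter (size cs) step (on_left (LeftScan I p) ([seq wcell x | x <- cs] ++ l) t) =
  on_left (LeftScan I (lift_scan fL p cs).1) l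
    (catrev [seq wcell x | x <- (lift_scan fL p cs).2] t).
Proof.
elim: cs p t => // x cs IH p t.
rewrite scan_cons iterSr /= -IH; congr iter.
rewrite /tm_step /=; case: lift_cell => p1 x1 /=.
by case: ([seq _ | _ <- _] ++ l).
Qed.

Lemma left_out_run p out l t :
  iter (size out) step (on_left (LeftScan I p) ([seq ocell a | a <- out] ++ l) t) =
  on_left (LeftScan I p) l (catrev [seq ocell a | a <- out] t).
Proof.
elim: out t => // a out IH t; rewrite iterSr /= -IH; congr iter.
by rewrite /tm_step /=; case: ([seq _ | _ <- _] ++ l).
Qed.

Lemma load_run i w l :
  exists i' cs, [/\ size cs = size w, pmap id cs = load_all i w &
  iter (size w) step (on_right (LoadInput P i) l [seq ocell a | a <- w]) =
  on_right (LoadInput P i') (catrev [seq wcell x | x <- cs] l) [::]].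
Proof.
elim: w i l => [|a w IH] i l; first by exists i, [::].
case ia: (load i a) => [i1 x].
have [i' [cs [sz cs_w run]]] := IH i1 (wcell x :: l).
exists i', (x :: cs); split; first by rewrite /= sz.
  by rewrite /= ia /= -cs_w; case: (x).
rewrite iterSr /= -run; congr iter.
by rewrite /tm_step /= ia; case: (map _ w).
Qed.

(** The numbers [i] and [j] count the blanks that occur explicitly in the lists; they concern the
    representation, not the tape. *)
Definition home (p : P) (cs : seq (option W)) (out : seq Sym) (i j : nat) :
    config sweeper :=
  on_right (RightScan I p) (blanks i)
    ([seq wcell x | x <- cs] ++ [seq ocell a | a <- out] ++ blanks j).

Lemma back_sweep_run p cs out i j :
  exists p' cs' i',
    [/\ size cs' = size cs,
        back_sweep p (pmap id cs) out = (p', pmap id cs', out) &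
    iter (size cs + size out).+1 step
      (on_left (LeftScan I p)
        (catrev [seq ocell a | a <- out] (catrev [seq wcell x | x <- cs] (blanks i)))
        (blanks j)) = home p' cs' out i' j].
Proof.
have [Ep Ecs] := pmap_lift_scan fL p (rev cs).
(* Leaving the data on the left uses up a listed blank if there is one, and turning back pushes
   one. *)
exists (turn (lift_scan fL p (rev cs)).1), (rev (lift_scan fL p (rev cs)).2), i.-1.+1.
split; first by rewrite size_rev size_scan size_rev.
  by rewrite pmap_rev Ecs Ep pmap_rev /back_sweep; case: (scan _ _ _).
rewrite !catrevE -!map_rev iterS iterD -(size_rev out) left_out_run.
rewrite -(size_rev cs) left_scan_run !catrevE -!map_rev revK /home.
case: (scan _ _ _) => q cs' /=.
rewrite /tm_step; case: i => [|i] /=; case: (rev cs') => [|x s] //=;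
  by case: (out) => [|a s] //=; case: (j).
Qed.

Lemma round_run p cs out i j :
  exists p' cs' out' i' j' t,
    [/\ size cs' = size cs, round (p, pmap id cs, out) = (p', pmap id cs', out'),
        size out' <= (size out).+1, t <= 2 * (size cs + size out) + 4 &
        iter t step (home p cs out i j) = home p' cs' out' i' j'].
Proof.
have [Ep Ecs] := pmap_lift_scan fR p cs.
rewrite /round; case sc: (scan fR p _) Ep Ecs => [p1 ws1] /= Ep Ecs.
case fin: (final p1); first by exists p, cs, out, i, j, 0.
set cs1 := (lift_scan fR p cs).2 in Ecs.
case ap: (act p1) => [p2 o] /=.
have [p' [cs' [i' [sz bs run]]]] :=
  back_sweep_run p2 cs1 (out ++ seq_of_opt o) i (if o is Some _ then j.-1 else j.-1.+1).
have szo : size (out ++ seq_of_opt o) = size out + (o : bool).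
  by rewrite size_cat; case: (o).
exists p', cs', (out ++ seq_of_opt o), i', (if o is Some _ then j.-1 else j.-1.+1).
(* Read from the right: right sweep, switch at the end of the data, crossing of the output, [act],
   return. A new symbol costs the return no extra step, since [act] already moves left off it. *)
exists ((size cs1 + size out).+1 + (1 + (size out + (1 + size cs)))).
split; first by rewrite sz size_scan.
- by rewrite -Ecs bs.
- by rewrite szo; case: (o) => [a|] /=; lia.
- by rewrite size_scan; lia.
rewrite iterD iterD iterD iterD right_scan_run Ep -/cs1.
set l := catrev _ (blanks i).
have -> : iter 1 step (on_right (RightScan I p1) l ([seq ocell a | a <- out] ++ blanks j)) =
    on_right (OutScan I p1) l ([seq ocell a | a <- out] ++ blanks j).
  by rewrite /tm_step; case: (out) => [|a s] /=; case: (j) => [|k] /=; rewrite fin.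
rewrite out_scan_run -run szo.
set l' := catrev _ l.
have -> : iter 1 step (on_right (OutScan I p1) l' (blanks j)) =
    on_left (LeftScan I p2) l' (omap inl o :: blanks j.-1).
  by rewrite /tm_step; case: (j) => [|k] /=; rewrite ap; case: (l').
case: o {ap run bs szo} => [a|] /=; last by rewrite addn0 cats0.
rewrite addnA addn1 map_cat catrev_catl -/l -/l'; congr (step _); rewrite iterSr; congr iter.
by rewrite /tm_step /=; case: (l').
Qed.

Lemma rounds_run k p cs out i j :
  exists p' cs' out' i' j' t,
    [/\ size cs' = size cs, iter k round (p, pmap id cs, out) = (p', pmap id cs', out'),
        size out' <= size out + k, t <= k * (2 * (size cs + size out + k) + 4) &
        iter t step (home p cs out i j) = home p' cs' out' i' j'].
Proof.
elim: k => [|k [p1 [cs1 [out1 [i1 [j1 [t1 [sz1 E1 le1 t1le run1]]]]]]]].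
  by exists p, cs, out, i, j, 0; split=> //; rewrite addn0.
have [p' [cs' [out' [i' [j' [t [sz E le tle run]]]]]]] := round_run p1 cs1 out1 i1 j1.
exists p', cs', out', i', j', (t + t1); split; rewrite ?sz //.
- by rewrite iterS E1 E.
- by lia.
- by rewrite sz1 in tle; nia.
- by rewrite iterD run1.
Qed.

Lemma read_out_ocells out j :
  @read_out sweeper ([seq ocell a | a <- out] ++ blanks j) = out.
Proof. by elim: out => [|a out /= ->] //; case: j. Qed.

(** The last right sweep halts with the head on the first cell after the data, where the output
    begins. The bound adds loading, one return, [k] rounds and this last sweep. *)
Lemma sweeper_outputs w k p ws out :
  iter k round (back_sweep p0 (load_all i0 w) [::]) = (p, ws, out) ->
  final (scan fR p ws).1 ->
  exists2 t, t <= k * (2 * (size w + k) + 4) + 3 * size w + 3 &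
    tm_outputs_within sweeper t w out.
Proof.
have [i [cs [sz cs_w run]]] := load_run i0 w [::].
have [p1 [cs1 [i1 [sz1 bs run1]]]] := back_sweep_run p0 cs [::] 0 1.
have [p2 [cs2 [out2 [i2 [j2 [t [sz2 E2 le2 tle run2]]]]]]] :=
  rounds_run k p1 cs1 [::] i1 1.
rewrite -cs_w bs E2 => -[<- <- <-] fin.
exists ((1 + size cs2) + (t + ((size cs + 0).+1 + (1 + size w)))).
  by move: tle; rewrite sz2 sz1 sz /=; lia.
rewrite /tm_outputs_within /tm_run.
have -> : tm_init sweeper w = on_right (LoadInput P i0) [::] [seq ocell a | a <- w] by [].
rewrite iterD (iterD t) (iterD (size cs + 0).+1) (iterD 1 (size w)) run.
have -> : iter 1 step (on_right (LoadInput P i) (catrev [seq wcell x | x <- cs] [::]) [::]) =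
    on_left (LeftScan I p0) (catrev [seq wcell x | x <- cs] [::]) [:: None].
  by rewrite /tm_step /=; case: (catrev _ _).
rewrite run1 run2 iterD right_scan_run (pmap_lift_scan fR p2 cs2).1.
set l := catrev _ _.
have -> : iter 1 step (on_right (RightScan I (scan fR p2 (pmap id cs2)).1) l
      ([seq ocell a | a <- out2] ++ blanks j2)) =
    on_right (Halted I P) l ([seq ocell a | a <- out2] ++ blanks j2).
  by rewrite /tm_step; case: (out2) => [|a s] /=; case: (j2) => [|m] /=; rewrite fin.
split=> //; rewrite -[RHS](read_out_ocells _ j2).
by case: (_ ++ _).
Qed.

End Sweeper.

(** * Kinds of parts and exchanges *)

(** Induction on the coordinates. Let [B] bound all elements from below when [t] is ignored. An
    element whose [t] is at least the maximum over [B] is bounded at [t] too; the others lie in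
    finitely many slices of constant [t], each handled by induction. *)
Lemma dickson (A T : eqType) (m : A -> T -> nat) (l : seq T) (X : A -> Prop) :
  exists B : seq A, (forall a, a \in B -> X a) /\
    forall a, X a -> exists2 a', a' \in B & forall t, t \in l -> m a' t <= m a t.
Proof.
elim: l X => [|t l IH] X.
  have [[a Xa]|noX] := classic (exists a, X a).
    exists [:: a]; split=> [a'|a' _]; first by rewrite inE => /eqP->.
    by exists a; rewrite ?inE.
  by exists [::]; split=> // a Xa; case: noX; exists a.
have [B [BX Bmin]] := IH X.
have slices N : exists C : seq A, (forall a, a \in C -> X a) /\
    forall a, X a -> m a t < N ->
      exists2 a', a' \in C & forall u, u \in t :: l -> m a' u <= m a u.
  elim: N => [|N [C [CX Cmin]]]; first by exists [::].
  have [D [DX Dmin]] := IH (fun a => X a /\ m a t = N).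
  exists (C ++ D); split=> [a|a Xa].
    by rewrite mem_cat => /orP[/CX //|/DX[]].
  rewrite ltnS leq_eqVlt => /orP[/eqP aN|aN].
    have [a' a'D le_a] := Dmin a (conj Xa aN).
    exists a' => [|u]; first by rewrite mem_cat a'D orbT.
    by rewrite inE => /orP[/eqP->|/le_a //]; rewrite aN (DX _ a'D).2.
  have [a' a'C le_a] := Cmin a Xa aN.
  by exists a' => //; rewrite mem_cat a'C.
have [C [CX Cmin]] := slices (\max_(a <- B) m a t).
exists (B ++ C); split=> [a|a Xa].
  by rewrite mem_cat => /orP[/BX|/CX].
have [small|large] := ltnP (m a t) (\max_(a <- B) m a t).
  have [a' a'C le_a] := Cmin a Xa small.
  by exists a' => //; rewrite mem_cat a'C orbT.
have [a' a'B le_a] := Bmin a Xa.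
exists a' => [|u]; first by rewrite mem_cat a'B.
rewrite inE => /orP[/eqP->|/le_a //].
by apply: leq_trans large; apply: (leq_bigmax_seq a').
Qed.

Lemma pairwise_mem (T : eqType) (r : rel T) (xs : seq T) (u v : T) :
  symmetric r -> pairwise r xs -> u \in xs -> v \in xs -> u != v -> r u v.
Proof.
move=> rC; elim: xs => //= x xs IH /andP[/allP rx rxs].
rewrite !inE => /orP[/eqP->|uxs] /orP[/eqP->|vxs] uv; rewrite ?eqxx // in uv *.
- exact: rx.
- by rewrite rC; apply: rx.
- exact: IH.
Qed.

Section Kinds.
Variable b : nat.
Local Notation str := (bstring b).
Local Notation kind := {set str}.

Definition zero_str : str := [tuple of nseq b false].

Lemma mesh_sym : symmetric (@mesh b).
Proof. by move=> s t; apply: eq_forallb => i; rewrite andbC. Qed.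

Lemma mesh0 s : mesh zero_str s.
Proof. by apply/forallP => i; rewrite (tnth_nth false) nth_nseq if_same. Qed.

Lemma mesh_self s : mesh s s = (s == zero_str).
Proof.
apply/idP/eqP => [/forallP ss|->]; last exact: mesh0.
apply: eq_from_tnth => i; have := ss i; rewrite andbb => /negbTE->.
by rewrite (tnth_nth false) nth_nseq if_same.
Qed.

(* A nonempty kind always contains the zero string, since a part can host any number
   of zero strings; the empty kind stands for an unused part. *)
Definition meshing_kind (K : kind) : bool :=
  (K == set0) || (zero_str \in K) &&
  [forall x in K, forall y in K, (x != y) ==> mesh x y].

Definition coverage (s : str) (Ks : seq kind) : nat := count (fun K : kind => s \in K) Ks.

Definition nb_used (Ks : seq kind) : nat := count (predC1 set0) Ks.

Lemma meshing_kind_mesh K x y :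
  meshing_kind K -> x \in K -> y \in K -> x != y -> mesh x y.
Proof.
case/orP => [/eqP->|/andP[_ /forall_inP KK] xK yK xy]; first by rewrite inE.
by have /forall_inP/(_ y yK)/implyP := KK x xK; apply.
Qed.

Lemma meshing_kind_zero K : meshing_kind K -> (zero_str \in K) = (K != set0).
Proof.
case/orP => [/eqP->|/andP[zK _]]; first by rewrite inE eqxx.
by rewrite zK; symmetry; apply/set0Pn; exists zero_str.
Qed.

Definition same_coverage (Ks Ts : seq kind) :=
  forall s, s != zero_str -> coverage s Ks = coverage s Ts.

Definition exchange (pq : seq kind * seq kind) : Prop :=
  [/\ all (predC1 set0) pq.1, all meshing_kind pq.2, size pq.2 < size pq.1
    & same_coverage pq.1 pq.2].

Definition fits (p Ks : seq kind) : Prop := forall K, count_mem K p <= count_mem K Ks.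

(** Only left sides are compared, because they alone decide whether an exchange applies. *)
Definition exchange_basis (B : seq (seq kind * seq kind)) : Prop :=
  (forall pq, pq \in B -> exchange pq) /\
  forall pq, exchange pq -> exists2 pq', pq' \in B & fits pq'.1 pq.1.

Definition irreducible (B : seq (seq kind * seq kind)) (Ks : seq kind) : Prop :=
  forall pq, pq \in B -> ~ fits pq.1 Ks.

Lemma exchange_basis_exists : exists B, exchange_basis B.
Proof.
have [B [BX Bmin]] := @dickson _ kind (fun pq K => count_mem K pq.1) (enum kind) exchange.
exists B; split=> // pq /Bmin[pq' pq'B le_pq].
by exists pq' => // K; apply: le_pq; rewrite mem_enum.
Qed.

Lemma coverage_used s Ks : coverage s (filter (predC1 set0) Ks) = coverage s Ks.
Proof.
rewrite /coverage count_filter; apply: eq_count => K /=.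
by case: eqP => [->|]; rewrite ?andbT // inE.
Qed.

(** If [Ts] were smaller, the nonempty kinds of [Ks] together with [Ts] would be an exchange. Some
    basis exchange fits into its left side, hence into [Ks]. *)
Lemma local_optimum B Ks Ts :
  exchange_basis B -> irreducible B Ks ->
  all meshing_kind Ts -> same_coverage Ks Ts -> nb_used Ks <= size Ts.
Proof.
move=> [_ Bmin] noB Tsm KsTs; rewrite leqNgt; apply/negP => lt_Ts.
have [|pq pqB pq_le] := Bmin (filter (predC1 set0) Ks, Ts).
  split; rewrite ?filter_all ?size_filter //= => s sz.
  by rewrite coverage_used KsTs.
apply: (noB pq pqB) => K; apply: leq_trans (pq_le K) _.
by rewrite count_filter; apply: sub_count => x /= /andP[].
Qed.

(** * From labelings to kinds *)

(** Used through [pairwise], it compares positions rather than values, so equal strings in one part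
    must mesh with themselves. *)
Definition label_rel (x y : str * nat) : bool := (x.2 == y.2) ==> mesh x.1 y.1.

Lemma label_rel_sym : symmetric label_rel.
Proof. by move=> x y; rewrite /label_rel eq_sym mesh_sym. Qed.

Lemma is_meshingP (S : seq str) lab :
  is_meshing S lab <-> size lab = size S /\ pairwise label_rel (zip S lab).
Proof.
rewrite /is_meshing; split=> -[szl H]; split=> //.
  apply/(pairwiseP (zero_str, 0)) => i j; rewrite !inE size_zip szl minnn => iS jS ij.
  rewrite !nth_zip //; apply/implyP => /eqP; exact: H.
move=> i j ij jS eq_l; have iS := ltn_trans ij jS.
move/(pairwiseP (zero_str, 0))/(_ i j): H; rewrite !inE size_zip szl minnn.
by move=> /(_ iS jS ij); rewrite !nth_zip // /label_rel /= eq_l eqxx.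
Qed.

(** A nonzero string does not mesh with itself, so its copies lie in different parts. *)
Lemma labels_of_uniq s (xs : seq (str * nat)) :
  s != zero_str -> pairwise label_rel xs ->
  uniq [seq x.2 | x <- xs & x.1 == s].
Proof.
move=> sz; elim: xs => //= -[s1 l1] xs IH /andP[/allP r1 /IH ?] /=.
case: eqP => //= ss1; rewrite ss1 in r1; apply/andP; split=> //.
apply/mapP => -[[s2 l2]]; rewrite mem_filter /= => /andP[/eqP-> /r1].
by rewrite /label_rel /= mesh_self (negbTE sz) implybF => /eqP ne12 eq12.
Qed.

(** Adding the zero string to every part is harmless, as it meshes with everything. By
    [labels_of_uniq] the number of parts containing a nonzero [s] is its multiplicity. *)
Lemma meshing_kinds (S : seq str) lab : is_meshing S lab ->
  exists Ts, [/\ size Ts = num_parts lab, all meshing_kind Ts &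
    forall s, s != zero_str -> coverage s Ts = count_mem s S].
Proof.
move=> /is_meshingP[szl pw].
pose part l : kind := zero_str |: [set s | (s, l) \in zip S lab].
exists [seq part l | l <- undup lab]; split; first by rewrite size_map.
  apply/allP => K /mapP[l _ ->]; apply/orP; right; rewrite !inE eqxx /=.
  apply/forall_inP => x; rewrite !inE => xl; apply/forall_inP => y; rewrite !inE => yl.
  apply/implyP => xy; case/orP: xl => [/eqP->|xl]; first exact: mesh0.
  case/orP: yl => [/eqP->|yl]; first by rewrite mesh_sym mesh0.
  have := pairwise_mem label_rel_sym pw xl yl; rewrite /label_rel /= eqxx; apply.
  by apply: contraNneq xy => -[->].
move=> s sz; rewrite /coverage count_map.
rewrite (eq_count (a2 := fun l => (s, l) \in zip S lab)); last first.
  by move=> l /=; rewrite !inE (negbTE sz).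
rewrite -size_filter.
have -> : count_mem s S = size [seq x.2 | x <- zip S lab & x.1 == s].
  rewrite size_map size_filter -[in LHS](@unzip1_zip _ _ S lab) ?szl //.
  by rewrite /unzip1 count_map.
apply: perm_size; apply: uniq_perm; first by rewrite filter_uniq ?undup_uniq.
  exact: labels_of_uniq.
move=> l; rewrite mem_filter mem_undup; apply/andP/mapP.
  by case=> sl _; exists (s, l); rewrite ?mem_filter ?eqxx.
case=> -[s' l']; rewrite mem_filter /= => /andP[/eqP-> s'l] ->; split=> //.
have := map_f snd s'l; rewrite -/(unzip2 _) unzip2_zip ?szl //.
Qed.

(** * From kinds to labelings: greedy placement *)

(* [use s K] is what a part of kind [K] still offers after receiving [s]. *)
Definition use (s : str) (K : kind) : kind := if s == zero_str then K else K :\ s.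

Fixpoint use_first (s : str) (Ks : seq kind) : seq kind :=
  if Ks is K :: Ks' then
    if s \in K then use s K :: Ks' else K :: use_first s Ks'
  else [::].

Local Notation slot s Ks := (find (fun K : kind => s \in K) Ks).

Fixpoint greedy (Ks : seq kind) (S : seq str) : seq nat :=
  if S is s :: S' then slot s Ks :: greedy (use_first s Ks) S' else [::].

Lemma use_sub s K : use s K \subset K.
Proof. by rewrite /use; case: ifP => // _; apply: subsetDl. Qed.

Lemma meshing_use s K : meshing_kind K -> meshing_kind (use s K).
Proof.
move=> mK; rewrite /use; case: eqP => // /eqP sz.
case/orP: mK => [/eqP->|/andP[zK KK]]; first by rewrite set0D /meshing_kind eqxx.
apply/orP; right; rewrite !inE eq_sym sz zK /=.
apply/forall_inP => x /setD1P[_ xK]; apply/forall_inP => y /setD1P[_ yK].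
by move/forall_inP/(_ x xK)/forall_inP: KK => /(_ y yK).
Qed.

Lemma size_use_first s Ks : size (use_first s Ks) = size Ks.
Proof. by elim: Ks => //= K Ks IH; case: ifP => //= _; rewrite IH. Qed.

Lemma meshing_use_first s Ks : all meshing_kind Ks -> all meshing_kind (use_first s Ks).
Proof.
elim: Ks => //= K Ks IH /andP[mK mKs]; case: ifP => _ /=.
  by rewrite meshing_use.
by rewrite mK IH.
Qed.

Lemma nth_use_first s Ks k :
  nth set0 (use_first s Ks) k =
  if k == slot s Ks then use s (nth set0 Ks k) else nth set0 Ks k.
Proof.
elim: Ks k => [|K Ks IH] [|k] //=.
- by rewrite /use set0D if_same.
- by case: ifP.
- by case: ifP => //= _; rewrite IH eqSS.
Qed.

Lemma coverage_use_first t s Ks : s \in nth set0 Ks (slot s Ks) ->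
  coverage t (use_first s Ks) = coverage t Ks - ((t == s) && (s != zero_str)).
Proof.
rewrite /coverage; elim: Ks => [|K Ks IH] /=; first by rewrite inE.
case: ifP => /= [sK _|sK /IH->].
  rewrite /use; have [->|sz] := eqVneq s zero_str; first by rewrite andbF subn0.
  rewrite !inE; have [->|ts] := eqVneq t s; rewrite ?sK /= ?subn0 //.
  by rewrite addKn.
by have [->|ts] := eqVneq t s; rewrite ?sK ?subn0.
Qed.


(* A single part can host all zero strings. *)
Definition demand (s : str) (S : seq str) : nat :=
  if s == zero_str then (s \in S : nat) else count_mem s S.

(** The invariant of [greedy]: covered demand yields a slot for the next string. Placing a nonzero
    string lowers its demand and its coverage by one; placing a zero string lowers no coverage. *)
Lemma demand_use_first Ks s S :
  (forall t, demand t (s :: S) <= coverage t Ks) ->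
  s \in nth set0 Ks (slot s Ks) /\
  forall t, demand t S <= coverage t (use_first s Ks).
Proof.
move=> dem.
have sK : s \in nth set0 Ks (slot s Ks).
  apply: (@nth_find _ set0 (fun K : kind => s \in K)); rewrite has_count.
  apply: leq_trans (dem s); rewrite /demand inE /= eqxx /=.
  by case: ifP.
split=> // t; have := dem t; rewrite (coverage_use_first t sK) /demand /= inE.
case: (eqVneq t zero_str) => [->|tz].
  have -> : (zero_str == s) && (s != zero_str) = false by case: eqVneq.
  by rewrite subn0; apply: leq_trans; case: (_ == s); case: (_ \in S).
case: (eqVneq t s) => [<-|ts]; first by rewrite tz /=; lia.
by rewrite subn0.
Qed.

Lemma size_greedy Ks S : size (greedy Ks S) = size S.
Proof. by elim: S Ks => //= s S IH Ks; rewrite IH. Qed.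

Lemma greedy_mem Ks S : (forall t, demand t S <= coverage t Ks) ->
  forall x, x \in zip S (greedy Ks S) -> x.1 \in nth set0 Ks x.2.
Proof.
elim: S Ks => //= s S IH Ks /demand_use_first[sK dem] x.
rewrite inE => /orP[/eqP-> //|/(IH _ dem)].
rewrite nth_use_first; case: ifP => // _; exact: subsetP (use_sub _ _) _.
Qed.

(** A later string with the same label lies in what [s] left of the kind. If it differs from [s],
    the kind meshes; if it equals [s], then [s] was not removed and so is zero. *)
Lemma greedy_pairwise Ks S : all meshing_kind Ks ->
  (forall t, demand t S <= coverage t Ks) -> pairwise label_rel (zip S (greedy Ks S)).
Proof.
elim: S Ks => //= s S IH Ks mKs /demand_use_first[sK dem].
rewrite IH ?meshing_use_first // andbT; apply/allP => x /(greedy_mem dem).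
rewrite nth_use_first /label_rel /= [_ == x.2]eq_sym; case: eqP => //= -> xK.
have xK' := subsetP (use_sub _ _) _ xK.
have [sx|sx] := eqVneq s x.1; last first.
  apply: meshing_kind_mesh sK xK' sx.
  have [lt_sz|ge_sz] := ltnP (slot s Ks) (size Ks); first exact: (all_nthP _ mKs).
  by rewrite nth_default // /meshing_kind eqxx.
move: xK; rewrite -sx mesh_self /use; case: eqP => // _.
by rewrite !inE eqxx.
Qed.

Lemma greedy_num_parts Ks S : (forall t, demand t S <= coverage t Ks) ->
  num_parts (greedy Ks S) <= nb_used Ks.
Proof.
move=> dem; have KsE : Ks = [seq nth set0 Ks k | k <- iota 0 (size Ks)].
  by rewrite map_nth_iota0 // take_size.
rewrite /nb_used [in leqRHS]KsE count_map -size_filter.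
apply: uniq_leq_size (undup_uniq _) _ => k; rewrite mem_undup mem_filter mem_iota /=.
rewrite -{1}(@unzip2_zip _ _ S (greedy Ks S)) ?size_greedy // => /mapP[x /(greedy_mem dem)].
move=> xk ->; apply/andP; split; first by apply: contraTneq xk => ->; rewrite inE.
by rewrite ltnNge; apply: contraL xk => ?; rewrite nth_default // inE.
Qed.

Lemma greedy_optimal B (S : seq str) Ks :
  exchange_basis B -> irreducible B Ks ->
  all meshing_kind Ks ->
  (forall s, s != zero_str -> coverage s Ks = count_mem s S) ->
  optimal_meshing S (greedy Ks S).
Proof.
move=> basisB noB mKs KsS.
suff [mesh_greedy le_parts] : is_meshing S (greedy Ks S) /\
    forall lab, is_meshing S lab -> num_parts (greedy Ks S) <= num_parts lab.
  by split=> // lab /le_parts le; apply: leq_sub2l.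
(* Zero strings find a slot only if some kind is nonempty. Otherwise all kinds are empty, [S]
   consists of zero strings, and all get the label [size Ks], the value of a failed [find]. *)
have [z0|zpos] := posnP (coverage zero_str Ks); last first.
  have dem t : demand t S <= coverage t Ks.
    rewrite /demand; case: eqVneq => [->|tz]; last by rewrite KsS.
    by apply: leq_trans zpos; case: (_ \in _).
  split; first by apply/is_meshingP; rewrite size_greedy greedy_pairwise.
  move=> lab /meshing_kinds[Ts [<- mTs TsS]].
  apply: leq_trans (greedy_num_parts dem) _.
  by apply: local_optimum basisB noB mTs _ => s sz; rewrite KsS ?TsS.
have empty K : K \in Ks -> K = set0.
  move=> KKs; apply/eqP; rewrite -[_ == _]negbK -meshing_kind_zero ?(allP mKs) //.
  apply/negP => zK; suff : 0 < coverage zero_str Ks by rewrite z0.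
  by rewrite -has_count; apply/hasP; exists K.
have no_cover s : coverage s Ks = 0.
  apply/eqP; rewrite -leqn0 leqNgt -has_count; apply/hasPn => K /empty->.
  by rewrite inE.
have Sz s : s \in S -> s = zero_str.
  move=> sS; apply/eqP/negPn/negP => sz.
  by move: (KsS s sz); rewrite no_cover => /esym/eqP; rewrite -leqn0 leqNgt -has_count has_pred1 sS.
have greedyE T : greedy Ks T = nseq (size T) (size Ks).
  elim: T => //= s T IHT.
  have find0 : slot s Ks = size Ks.
    by apply/eqP; rewrite eqn_leq find_size leqNgt -has_find has_count -/(coverage s Ks) no_cover.
  rewrite find0; congr (_ :: _); rewrite -IHT; congr greedy.
  apply: (@eq_from_nth _ set0); first exact: size_use_first.
  move=> k; rewrite size_use_first nth_use_first find0; case: eqP => // ->.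
  by rewrite ltnn.
rewrite greedyE; split.
  split=> [|i j ij jS _]; first by rewrite size_nseq.
  by rewrite (Sz (nth _ S i)) ?mesh0 // mem_nth // (ltn_trans ij).
case: S {KsS Sz greedyE} => [|s S] lab [szl _]; first by [].
(* A single label is optimal for a nonempty [S]. *)
apply: (@leq_trans 1).
  apply: (@uniq_leq_size _ _ [:: size Ks]) (undup_uniq _) _ => k.
  by rewrite mem_undup => /nseqP[-> _]; rewrite inE.
by case: lab szl => // k lab _; rewrite -has_predT; apply/hasP;
  exists k; rewrite ?mem_undup ?mem_head.
Qed.

End Kinds.

(** * The meshing machine *)

(** [Count] and [Replace] serve the local search; the latter carries the kinds still to be removed
    and inserted, bounded in length to keep the type finite. The other phases take a string, seek
    its cell and write its label. *)
Inductive phase (b c : nat) :=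
  | Count of {ffun {set bstring b} -> 'I_c.+1}
  | Replace of c.-bseq {set bstring b} & c.-bseq {set bstring b}
  | Fetch
  | Got of bstring b
  | Walk of bstring b
  | Emit of bstring b
  | Done.
Arguments Count {b c}.
Arguments Replace {b c}.
Arguments Fetch {b c}.
Arguments Got {b c}.
Arguments Walk {b c}.
Arguments Emit {b c}.
Arguments Done {b c}.

Section PhaseFinite.
Variables (b c : nat).
Local Notation str := (bstring b).
Local Notation kind := {set str}.
Local Notation code_type :=
  (option (option ({ffun kind -> 'I_c.+1} + (c.-bseq kind * c.-bseq kind) +
                   (str + (str + str)))))%type.

Definition phase_code (p : phase b c) : code_type :=
  match p with
  | Count st => Some (Some (inl (inl st)))
  | Replace p q => Some (Some (inl (inr (p, q))))
  | Fetch => Some None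
  | Got s => Some (Some (inr (inl s)))
  | Walk s => Some (Some (inr (inr (inl s))))
  | Emit s => Some (Some (inr (inr (inr s))))
  | Done => None
  end.

Definition phase_decode (x : code_type) : phase b c :=
  match x with
  | Some (Some (inl (inl st))) => Count st
  | Some (Some (inl (inr (p, q)))) => Replace p q
  | Some None => Fetch
  | Some (Some (inr (inl s))) => Got s
  | Some (Some (inr (inr (inl s)))) => Walk s
  | Some (Some (inr (inr (inr s)))) => Emit s
  | None => Done
  end.

Lemma phase_codeK : cancel phase_code phase_decode.
Proof. by case. Qed.

HB.instance Definition _ := Finite.copy (phase b c) (can_type phase_codeK).
End PhaseFinite.

Section Meshing.
Variable b : nat.
Local Notation str := (bstring b).
Local Notation kind := {set str}.
Local Notation slot s Ks := (find (fun K : kind => s \in K) Ks).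
Variables (B : seq (seq kind * seq kind)) (c : nat).
Hypothesis basisB : exchange_basis B.
Hypothesis sizeB : forall pq, pq \in B -> size pq.1 <= c.

(* A cell holds an input string until it is labelled, a mark for the cells already
   passed while the current label is written, and the kind of a part. *)
Local Notation cell := (option str * bool * kind)%type.
Local Notation phase := (phase b c).

(* The last [b] bits read; the initial value is irrelevant once [b] bits are read. *)
Definition shift (t : str) (x : bool) : str := [tuple of behead (rcons t x)].

(** A zero string gets no part of its own, since any used part can host it. *)
Definition start_kind (s : str) : kind :=
  if s == zero_str b then set0 else [set zero_str b; s].

Definition start_cell (s : str) : cell := (Some s, false, start_kind s).

Definition load_string (t : str) (a : Sym) : str * option cell :=
  match a with
  | S0 => (shift t false, None)
  | S1 => (shift t true, None)
  | Sep => (t, Some (start_cell t))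
  end.

Definition count0 : {ffun kind -> 'I_c.+1} := [ffun => ord0].

(** Counters saturate at [c]. The marks are a unary counter: a [Walk] round whose first unmarked
    cell does not offer [s] marks that cell and leads to one more [S1]. *)
Definition right_move (p : phase) (x : cell) : phase * cell :=
  let: (o, v, K) := x in
  match p with
  | Count st => (Count [ffun L => inord (minn c (st L + (K == L)))], x)
  | Fetch => if o is Some s then (Got s, (None, v, K)) else (p, x)
  | Walk s =>
      if v then (p, x)
      else if s \in K then (Done, (o, v, use s K)) else (Emit s, (o, true, K))
  | _ => (p, x)
  end.

(** Once [q1] is exhausted, [head set0] writes the empty kind, which releases a part. *)
Definition left_move (p : phase) (x : cell) : phase * cell :=
  let: (o, v, K) := x in
  match p with
  | Replace p1 q1 =>
      if K \in (p1 : seq kind) then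
        (Replace (insub_bseq c (rem K p1)) (insub_bseq c (behead q1)),
         (o, v, head set0 q1))
      else (p, x)
  | Done => (p, (o, false, K))
  | _ => (p, x)
  end.

Definition choose_exchange (st : {ffun kind -> 'I_c.+1}) : phase :=
  if [seq pq <- B | [forall K, count_mem K pq.1 <= st K]] is pq :: _
  then Replace (insub_bseq c pq.1) (insub_bseq c pq.2) else Fetch.

(** Still being in [Walk] means that every cell is marked, so the label is the number of cells, as
    for a failed [find]. *)
Definition right_end (p : phase) : phase * option Sym :=
  match p with
  | Count st => (choose_exchange st, None)
  | Walk _ => (Done, Some Sep)
  | Emit _ => (p, Some S1)
  | Done => (p, Some Sep)
  | _ => (p, None)
  end.

Definition left_end (p : phase) : phase :=
  match p with
  | Replace _ _ => Count count0
  | Count _ => Count count0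
  | Got s => Walk s
  | Emit s => Walk s
  | Done => Fetch
  | _ => p
  end.

(** Tested after a right sweep, so it holds when no string is left. The [Fetch] that ends the search
    arises after the test and does not halt the machine. *)
Definition is_fetch (p : phase) : bool := if p is Fetch then true else false.

Local Notation mround := (round right_move left_move is_fetch right_end left_end).
Local Notation back := (back_sweep left_move left_end).
Local Notation strs d := [seq x.1.1 | x <- d].
Local Notation marks d := [seq x.1.2 | x <- d].
Local Notation kinds d := [seq x.2 | x <- d].

Lemma back_id p d out : (forall x, left_move p x = (p, x)) ->
  back p d out = (left_end p, d, out).
Proof. by move=> idp; rewrite /back_sweep scan_id // revK. Qed.

(** * Reading the input *)

Lemma load_bits (t : str) (s : seq bool) w :
  load_all load_string t ([seq (if x then S1 else S0) | x <- s] ++ w) =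
  load_all load_string (foldl shift t s) w.
Proof. by elim: s t => //= x s IH t; case: x; rewrite /= IH. Qed.

Lemma foldl_shift (t s : str) : foldl shift t s = s.
Proof.
have val_shift (l : seq bool) (u : str) : val (foldl shift u l) = drop (size l) (u ++ l).
  elim: l u => [|x l IH] u; first by rewrite drop0 cats0.
  rewrite /= IH /= -cat_rcons.
  by case: (rcons u x) (size_rcons u x).
by apply: val_inj; rewrite val_shift size_tuple drop_size_cat // size_tuple.
Qed.

Lemma load_enc t (S : seq str) :
  load_all load_string t (enc_input S) = [seq start_cell s | s <- S].
Proof.
rewrite /enc_input; elim: S t => //= s S IH t.
by rewrite -catA load_bits foldl_shift /= IH.
Qed.

Lemma size_enc_input (S : seq str) : size (enc_input S) = b.+1 * size S.
Proof.
rewrite /enc_input; elim: S => [|s S IH] /=; first by rewrite muln0.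
by rewrite !size_cat IH size_map size_tuple /=; lia.
Qed.

(** * Local search by sweeps *)

Lemma count_scan (st : {ffun kind -> 'I_c.+1}) d :
  scan right_move (Count st) d =
  (Count [ffun K => inord (minn c (st K + count_mem K (kinds d)))], d).
Proof.
elim: d st => [|[[o v] K] d IH] st /=.
  congr (Count _, _); apply/ffunP => L; rewrite ffunE addn0.
  by rewrite (minn_idPr _) ?inord_val // -ltnS.
rewrite IH; congr (Count _, _); apply/ffunP => L; rewrite !ffunE.
apply: val_inj; rewrite /= !inordK ?ltnS ?geq_minl //.
by move: (nat_of_bool _) (count_mem _ _) (nat_of_ord _) => x y z; lia.
Qed.

(* Counting up to [c] decides [fits p Ks] for the exchanges, whose size is at most [c]. *)
Definition tally (Ks : seq kind) : {ffun kind -> 'I_c.+1} :=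
  [ffun K => inord (minn c (count_mem K Ks))].

Lemma fitsP (p Ks : seq kind) : size p <= c ->
  reflect (fits p Ks)
    [forall K, count_mem K p <= tally Ks K].
Proof.
move=> szp; have le_c K : count_mem K p <= c by apply: leq_trans szp; apply: count_size.
by apply: (iffP forallP) => H K; have := H K;
  rewrite ffunE inordK ?ltnS ?geq_minl // leq_min le_c.
Qed.

Lemma insub_bseqK (s : seq kind) : size s <= c -> insub_bseq c s = s :> seq kind.
Proof. by move=> ?; rewrite insubdK. Qed.

(** By [fits], all of [p] is met and removed. Keeping [p] on the left of the permutation avoids
    subtracting multisets. *)
Lemma replace_scan (p q : c.-bseq kind) d :
  fits p (kinds d) -> size q <= size p ->
  exists p' q' d', [/\ scan left_move (Replace p q) d = (Replace p' q', d'),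
    strs d' = strs d, marks d' = marks d &
    perm_eq (kinds d' ++ p) (kinds d ++ q ++ nseq (size p - size q) set0)].
Proof.
elim: d p q => [|[[o v] K] d IH] p q fit le_qp.
  exists p, q, [::]; split=> //=.
  have p0 : p = [::] :> seq kind.
    by case: (val p) fit => // K s /(_ K); rewrite /= eqxx.
  by move: le_qp; rewrite p0 /=; case: (val q).
case: (boolP (K \in (p : seq kind))) => [Kp|Kp]; last first.
  have [L|//|p' [q' [d' [sc sd md pe]]]] := IH p q.
    have := fit L; rewrite /=; case: eqP => // <- _.
    by rewrite (count_memPn Kp).
  exists p', q', ((o, v, K) :: d'); rewrite scan_cons /= (negbTE Kp) sc /= sd md.
  by split=> //; rewrite perm_cons.
have szp : size (rem K p) <= c by rewrite size_rem // (leq_trans (leq_pred _)) ?size_bseq.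
have szq : size (behead q) <= c by rewrite size_behead (leq_trans (leq_pred _)) ?size_bseq.
have p_pos : 0 < size p by case: (val p) Kp.
have [L||p' [q' [d' [sc sd md pe]]]] :=
  IH (insub_bseq c (rem K p)) (insub_bseq c (behead q)).
- by rewrite insub_bseqK //; have := fit L; rewrite (permP (perm_to_rem Kp)) /= leq_add2l.
- by rewrite !insub_bseqK // size_rem // size_behead -!subn1 leq_sub2r.
exists p', q', ((o, v, head set0 q) :: d'); rewrite scan_cons /= Kp /= sc /= sd md.
split=> //; apply/permP => a; move/permP/(_ a): pe.
rewrite !insub_bseqK // size_rem // size_behead !count_cat /= !count_cat.
rewrite (permP (perm_to_rem Kp)) /= !count_nseq.
move: p_pos; case: (size p) => // m _; case: (val q) => [|L l] /=.
  rewrite subn0 mulnS; move: (nat_of_bool _) (nat_of_bool (a K)) => x y.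
  by move: (count a _) (count a _) (count a _) (_ * m) => *; lia.
rewrite subSS; move: (nat_of_bool _) (nat_of_bool (a K)) (a _ * _) => x y z.
by move: (count a _) (count a _) (count a _) (count a _) => *; lia.
Qed.


Lemma start_round d out :
  mround (Count count0, d, out) =
  back (choose_exchange (tally (kinds d))) d out.
Proof.
rewrite /round count_scan /= cats0; congr back_sweep; congr choose_exchange.
by apply/ffunP => K; rewrite !ffunE.
Qed.

Lemma choose_exchangeP (d : seq cell) :
  (choose_exchange (tally (kinds d)) = Fetch /\
    irreducible B (kinds d)) \/
  exists2 pq : seq kind * seq kind, pq \in B & fits pq.1 (kinds d) /\
    choose_exchange (tally (kinds d)) =
    Replace (insub_bseq c pq.1) (insub_bseq c pq.2).
Proof.
rewrite /choose_exchange; case E: (filter _ B) => [|pq l].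
  left; split=> // pq pqB /(fitsP _ (sizeB pqB)) ft.
  by have : pq \in [::] by rewrite -E mem_filter ft.
right; have : pq \in pq :: l by rewrite mem_head.
rewrite -E mem_filter => /andP[ft pqB]; exists pq => //; split=> //.
exact/fitsP/ft/sizeB.
Qed.

Definition covers_all (Ks : seq kind) (S : seq str) : Prop :=
  all (@meshing_kind b) Ks /\
  forall s, s != zero_str b -> coverage s Ks = count_mem s S.

(** Each claim counts one predicate on both sides of the permutation; the empty kinds contribute
    nothing. *)
Lemma exchange_step (p q Ks Ts : seq kind) S n :
  exchange (p, q) -> perm_eq (Ts ++ p) (Ks ++ q ++ nseq n set0) ->
  covers_all Ks S -> covers_all Ts S /\ nb_used Ts < nb_used Ks.
Proof.
move=> [/= used_p mesh_q lt_qp same_pq] pe [mesh_Ks KsS]; split; first split.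
- have : all (@meshing_kind b) (Ts ++ p).
    rewrite (perm_all _ pe) !all_cat mesh_Ks mesh_q /=.
    by apply/allP => K /nseqP[-> _]; rewrite /meshing_kind eqxx.
  by rewrite all_cat => /andP[].
- move=> s sz; rewrite -(KsS s sz); apply/eqP; rewrite -(eqn_add2r (coverage s p)).
  have := permP pe (fun K : kind => s \in K); rewrite !count_cat => ->.
  by rewrite count_nseq inE mul0n addn0 (same_pq s sz).
- have := permP pe (predC1 set0); rewrite !count_cat count_nseq /= eqxx mul0n addn0.
  rewrite -[X in _ + X = _]/(nb_used p) /nb_used; move: used_p; rewrite all_count => /eqP->.
  have := count_size (predC1 set0) q; move: lt_qp.
  by move: (count _ Ts) (count _ Ks) (count _ q) (size p) (size q) => *; lia.
Qed.

Lemma search_round S d out : covers_all (kinds d) S ->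
  (mround (Count count0, d, out) = (Fetch, d, out) /\
    irreducible B (kinds d)) \/
  exists d', [/\ mround (Count count0, d, out) = (Count count0, d', out),
    strs d' = strs d, marks d' = marks d, covers_all (kinds d') S &
    nb_used (kinds d') < nb_used (kinds d)].
Proof.
move=> cov; rewrite start_round.
have [[-> nofit]|[pq pqB [ft ->]]] := choose_exchangeP d.
  by left; split=> //; rewrite back_id // => -[[]].
right; have exch := proj1 basisB _ pqB; have [_ _ lt_qp _] := exch.
have szp := sizeB pqB; have szq : size pq.2 <= c by apply: leq_trans szp; apply: ltnW.
(* The left sweep meets the cells in reverse order, which does not affect fitting. *)
have [||p' [q' [d' [sc sd md pe]]]] :=
    @replace_scan (insub_bseq c pq.1) (insub_bseq c pq.2) (rev d).
- by move=> K; rewrite insub_bseqK // map_rev count_rev; apply: ft.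
- by rewrite !insub_bseqK // ltnW.
exists (rev d'); rewrite /back_sweep sc /= !map_rev sd md !map_rev !revK.
rewrite !insub_bseqK // map_rev in pe.
have pe' : perm_eq (rev (kinds d') ++ pq.1)
    (kinds d ++ pq.2 ++ nseq (size pq.1 - size pq.2) set0).
  by apply/permP => a; move/permP/(_ a): pe; rewrite !count_cat !count_rev.
have exch' : exchange (pq.1, pq.2) by case: (pq) exch.
by have [] := exchange_step exch' pe' cov.
Qed.

(** Each successful round lowers [nb_used]; one more round finds no exchange. *)
Lemma search_run S d out m : covers_all (kinds d) S -> nb_used (kinds d) <= m ->
  exists k d', [/\ k <= m.+1, iter k mround (Count count0, d, out) = (Fetch, d', out),
    strs d' = strs d /\ marks d' = marks d,
    covers_all (kinds d') S & irreducible B (kinds d')].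
Proof.
elim: m d => [|m IH] d cov le_m;
  have [[rd nofit]|[d1 [rd sd md cov1 lt_used]]] := search_round out cov.
- by exists 1, d.
- by move: lt_used; rewrite ltnNge (leq_trans le_m).
- by exists 1, d.
have [|k [d' [lek run [sd' md'] cov' nofit]]] := IH d1 cov1.
  by rewrite -ltnS; apply: leq_trans lt_used le_m.
exists k.+1, d'; rewrite iterSr rd sd' md'; split=> //.
Qed.

(** * Writing the labels *)

Lemma fetch_scan s rest n d : strs d = nseq n None ++ Some s :: rest ->
  exists d', [/\ scan right_move Fetch d = (Got s, d'),
    strs d' = nseq n.+1 None ++ rest, marks d' = marks d & kinds d' = kinds d].
Proof.
elim: d n => [|[[o v] K] d IH] [|n] //= [-> sd].
  by exists ((None, v, K) :: d); rewrite scan_id //= ?sd // => -[[]].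
have [d' [sc sd' md kd]] := IH n sd; exists ((None, v, K) :: d').
by rewrite sc /= sd' md kd.
Qed.

Lemma fetch_scan_none n d : strs d = nseq n None -> scan right_move Fetch d = (Fetch, d).
Proof. by elim: d n => [|[[o v] K] d IH] [|n] //= [-> /IH->]. Qed.

Lemma fetch_round s rest n d out : strs d = nseq n None ++ Some s :: rest ->
  exists d', [/\ mround (Fetch, d, out) = (Walk s, d', out),
    strs d' = nseq n.+1 None ++ rest, marks d' = marks d & kinds d' = kinds d].
Proof.
move=> /fetch_scan[d' [sc sd md kd]]; exists d'; split=> //.
by rewrite /round sc /= cats0 back_id // => -[[]].
Qed.

Definition set_mark (v : bool) (x : cell) : cell := (x.1.1, v, x.2).

Lemma walk_scan_marked s d :
  scan right_move (Walk s) (map (set_mark true) d) = (Walk s, map (set_mark true) d).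
Proof. by elim: d => //= x d ->. Qed.

Lemma done_scan d : scan left_move Done d = (Done, map (set_mark false) d).
Proof. by elim: d => // -[[o v] K] d IH; rewrite scan_cons /= IH. Qed.

Lemma set_markK v w d : map (set_mark v) (map (set_mark w) d) = map (set_mark v) d.
Proof. by rewrite -map_comp. Qed.

Lemma done_back d out : back Done d out = (Fetch, map (set_mark false) d, out).
Proof. by rewrite /back_sweep done_scan -map_rev revK. Qed.

(** Induction on the unmarked cells [d2]: each failed round moves one cell to the marked prefix [d1]
    and writes one [S1]. *)
Lemma walk_run s d1 d2 out : all (fun x : cell => s \notin x.2) d1 ->
  exists k d', [/\ k <= (size d2).+1,
    iter k mround (Walk s, map (set_mark true) d1 ++ map (set_mark false) d2, out) =
      (Fetch, map (set_mark false) d', out ++ nseq (slot s (kinds d2)) S1 ++ [:: Sep]),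
    strs d' = strs (d1 ++ d2) & kinds d' = kinds d1 ++ use_first s (kinds d2)].
Proof.
elim: d2 d1 out => [|x d2 IH] d1 out d1s /=.
  exists 1, d1; split; rewrite ?cats0 //=.
  by rewrite walk_scan_marked /= done_back set_markK.
have [sx|sx] := boolP (s \in x.2).
  exists 1, (d1 ++ (x.1, use s x.2) :: d2); split; rewrite ?map_cat //=.
  rewrite scan_cat walk_scan_marked scan_cons /= sx scan_id /=; last by case=> -[].
  by rewrite done_back !map_cat /= !set_markK.
have [|k [d' [lek run sd kd]]] := IH (rcons d1 x) (rcons out S1).
  by rewrite all_rcons sx.
exists k.+1, d'; split=> //.
- rewrite iterSr /round scan_cat walk_scan_marked scan_cons /= (negbTE sx) scan_id /=;
    last by case=> -[].
  rewrite back_id; last by case=> -[].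
  by move: run; rewrite map_rcons cat_rcons -cats1 -catA.
- by rewrite sd cat_rcons.
- by rewrite kd map_rcons cat_rcons.
Qed.

Lemma unmarkedP d : d = map (set_mark false) d <-> all (fun v => ~~ v) (marks d).
Proof.
split=> [->|]; first by apply/allP => v /mapP[x /mapP[y _ ->] ->].
by elim: d => // -[[o v] K] d IH /= /andP[/negbTE-> /IH <-].
Qed.

Lemma enc_labels_cons k lab : enc_labels (k :: lab) = nseq k S1 ++ Sep :: enc_labels lab.
Proof. by rewrite /enc_labels /= -catA. Qed.

(** A string costs one round to fetch and at most [size d + 1] rounds to place. *)
Lemma output_run S n d out :
  strs d = nseq n None ++ [seq Some s | s <- S] -> d = map (set_mark false) d ->
  exists k d' m, [/\ k <= size S * (size d + 2),
    iter k mround (Fetch, d, out) = (Fetch, d', out ++ enc_labels (greedy (kinds d) S)) &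
    strs d' = nseq m None].
Proof.
elim: S n d out => [|s S IH] n d out sd md.
  by exists 0, d, n; split=> //=; rewrite ?cats0 // sd cats0.
have [d1 [fr sd1 md1 kd1]] := fetch_round out sd.
have d1E : d1 = map (set_mark false) d1 by apply/unmarkedP; rewrite md1; apply/unmarkedP.
have [k2 [d2 [le2 run2 sd2 kd2]]] := @walk_run s [::] d1 out isT.
have sz1 : size d1 = size d by have := congr1 size kd1; rewrite !size_map.
have sz2 : size d2 = size d.
  by have := congr1 size kd2; rewrite /= size_use_first !size_map sz1.
have [||k3 [d3 [m [le3 run3 sd3]]]] := IH n.+1 (map (set_mark false) d2)
    (out ++ nseq (slot s (kinds d1)) S1 ++ [:: Sep]).
- by rewrite -map_comp sd2.
- by rewrite set_markK.
exists (k3 + (k2 + 1)), d3, m; split=> //.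
  by move: le2 le3; rewrite size_map sz1 sz2 /=; lia.
rewrite cat0s -d1E in run2; rewrite iterD iterD -[iter 1 _ _]/(mround _) fr run2 run3.
by rewrite -map_comp (eq_map (g := snd)) // kd2 kd1 enc_labels_cons -!catA.

Qed.

(** * Correctness and running time *)

Lemma start_covers (S : seq str) : covers_all [seq start_kind s | s <- S] S.
Proof.
split=> [|s sz].
  apply/allP => K /mapP[s _ ->]; rewrite /start_kind; case: eqVneq => [_|sz].
    by rewrite /meshing_kind eqxx.
  rewrite /meshing_kind !inE eqxx /=; apply/orP; right.
  apply/forall_inP => x; rewrite !inE => xs; apply/forall_inP => y; rewrite !inE => ys.
  apply/implyP => xy; case/orP: xs xy => /eqP-> xy; first exact: mesh0.
  by case/orP: ys xy => /eqP->; rewrite ?eqxx // mesh_sym mesh0.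
rewrite /coverage count_map; apply: eq_count => t /=; rewrite /start_kind.
case: eqVneq => [->|tz]; first by rewrite inE eq_sym (negbTE sz).
by rewrite !inE (negbTE sz) eq_sym.
Qed.

Definition mesher : TM :=
  sweeper (zero_str b) (Count count0) load_string right_move left_move is_fetch
    right_end left_end.

Lemma mesher_optimal (S : seq str) :
  exists lab k t, [/\ k <= (size S).+1 * (size S + 2),
    t <= k * (2 * (b.+1 * size S + k) + 4) + 3 * (b.+1 * size S) + 3,
    tm_outputs_within mesher t (enc_input S) (enc_labels lab) & optimal_meshing S lab].
Proof.
pose d0 := [seq start_cell s | s <- S].
have kd0 : kinds d0 = [seq start_kind s | s <- S] by rewrite -map_comp.
have cov0 : covers_all (kinds d0) S by rewrite kd0; apply: start_covers.
have used0 : nb_used (kinds d0) <= size S.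
  by rewrite (leq_trans (count_size _ _)) // !size_map.
have [k1 [d1 [le1 run1 [sd1 md1] cov1 nofit]]] := search_run [::] cov0 used0.
have sz1 : size d1 = size S.
  by have := congr1 size sd1; rewrite !size_map.
have [||k2 [d2 [m [le2 run2 sd2]]]] := @output_run S 0 d1 [::].
- by rewrite sd1 -map_comp.
- apply/unmarkedP; rewrite md1 -map_comp; apply/allP => v /mapP[s _ ->] //.
exists (greedy (kinds d1) S), (k2 + k1).
have start : back (Count count0) (load_all load_string (zero_str b) (enc_input S)) [::] =
    (Count count0, d0, [::]) by rewrite load_enc back_id // => -[[]].
have [||t le_t out_t] := @sweeper_outputs _ _ _ (zero_str b) (Count count0) load_string
  right_move left_move is_fetch right_end left_end (enc_input S) (k2 + k1) Fetch d2
  (enc_labels (greedy (kinds d1) S)).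
- by rewrite start iterD run1 run2.
- by rewrite (fetch_scan_none sd2).
exists t; split=> //.
- by move: le1 le2; rewrite sz1; nia.
- by move: le_t; rewrite size_enc_input.
- exact: greedy_optimal basisB nofit (proj1 cov1) (proj2 cov1).
Qed.

End Meshing.

Theorem theorem5p1 (b : nat) :
  exists (M : TM) (c d : nat),
    forall S : seq (bstring b),
      exists (t : nat) (lab : seq nat),
        t <= c * (size S) ^ d + c /\
        tm_outputs_within M t (enc_input S) (enc_labels lab) /\
        optimal_meshing S lab.
Proof.
have [B basisB] := exchange_basis_exists b.
pose c := \max_(pq <- B) size pq.1.
have sizeB pq : pq \in B -> size pq.1 <= c by move=> pqB; apply: (leq_bigmax_seq pq).
(* There are quadratically many rounds, each at most quadratic in time because the output grows with
   the rounds; hence degree 4. *)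
exists (mesher B c), (1000 * b.+1), 4 => S.
have [lab [k [t [lek let_ out opt]]]] := mesher_optimal basisB sizeB S.
exists t, lab; split=> //.
apply: leq_trans let_ _; move: (size S) lek => n lek.
have [n0|npos] := posnP n.
  rewrite n0 in lek *; rewrite muln0 exp0n //.
  have : k <= 2 by lia.
  by case: k {lek} => [|[|[|]]] //; lia.
(* All bounds are expressed through [m = n ^ 2], using [(n + 1) * (n + 2) <= 2 * n * (3 * n)] for
   positive [n]. *)
have -> : n ^ 4 = n ^ 2 * n ^ 2 by rewrite -expnD.
have n_le : n <= n ^ 2 by rewrite expnS leq_pmulr ?expn1.
have k_le : k <= 6 * n ^ 2.
  by apply: leq_trans lek _; rewrite -[6]/(2 * 3) expnS expn1 mulnACA leq_mul //; lia.
have m_pos : 0 < n ^ 2 by rewrite expn_gt0 npos.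
move: (n ^ 2) n_le k_le m_pos => m n_le k_le m_pos.
have Bn_le : b.+1 * n <= b.+1 * m by rewrite leq_mul2l n_le orbT.
have m_le : b.+1 * m <= b.+1 * (m * m) by rewrite leq_mul2l leq_pmulr ?orbT.
have mm_le : m * m <= b.+1 * (m * m) by rewrite leq_pmull.
have mm_ge : m <= m * m by rewrite leq_pmulr.
have : k * (2 * (b.+1 * n + k) + 4) <= 6 * m * (2 * (b.+1 * m + 6 * m) + 4).
  by rewrite leq_mul //; lia.
by nia.
Qed.
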